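(* Let $v, k$ be integers with $2 \le k \le v$, let $\ell \in \mathbb{R}^v$ and let $\beta_{\max} \in \mathbb{R}$. Define $\ell' \in \mathbb{R}^v$ by $\ell'_i = \ell_i + \beta_{\max}$ for $i \in \{1,\dots,k-1\}$ and $\ell'_i = \ell_i$ otherwise, and let $p = \operatorname{softmax}(\ell)$ and $p' = \operatorname{softmax}(\ell')$. Suppose that $p_v$ is the maximum of $p_1, \dots, p_v$. Then for every $i \in \{1,\dots,k-1\}$, $$p_i = \exp(\log p'_i - \beta_{\max} - \log p'_v + \log p_v).$$
   Context: For $x \in \mathbb{R}^v$, $\operatorname{softmax}(x)_i = \exp(x_i) / \sum_{j=1}^v \exp(x_j)$. Here $p$ is the unbiased next-token distribution of a language model with logits $\ell$, and $p'$ is the distribution obtained after adding a logit bias $\beta_{\max}$ to tokens $1,\dots,k-1$ (and not to token $v$). *)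

(* Defs.v *)
From mathcomp Require Import all_boot all_order all_algebra.
From mathcomp Require Import reals sequences exp.

Set Implicit Arguments.
Unset Strict Implicit.
Unset Printing Implicit Defensive.

Import Order.TTheory GRing.Theory Num.Theory.
Local Open Scope ring_scope.

Definition softmax (R : realType) (v : nat) (x : 'rV[R]_v) : 'rV[R]_v :=
  \row_i (expR (x 0 i) / \sum_(j < v) expR (x 0 j)).

(* Tokens are numbered from 1 in the text and from 0 in 'I_v: [i : 'I_v] is
   token number i.+1, so tokens 1, ..., k-1 are the [i] with i.+1 < k. *)
Definition bias_logits (R : realType) (v k : nat) (beta : R) (l : 'rV[R]_v) :
    'rV[R]_v :=
  \row_i (if (i.+1 < k)%N then l 0 i + beta else l 0 i).

(* Main.v *)
(* The normalizing sums cancel in differences of log-probabilities, so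
   log p_i - log p_v = l_i - l_v and likewise for p' and l'. Token v is not
   biased since k <= v, hence the two differences differ by beta_max. *)
Require Import Defs.
From mathcomp Require Import all_boot all_order all_algebra.
From mathcomp Require Import reals sequences exp.
From mathcomp Require Import ring.

Set Implicit Arguments.
Unset Strict Implicit.
Unset Printing Implicit Defensive.

Import Order.TTheory GRing.Theory Num.Theory.
Local Open Scope ring_scope.

(** The index [i] witnesses that the sum is nonempty: its term is positive and the others are
    nonnegative. *)
Lemma sum_expR_gt0 (R : realType) (v : nat) (x : 'rV[R]_v) (i : 'I_v) :
  0 < \sum_(j < v) expR (x 0 j).
Proof.
rewrite (bigD1 i) //= ltr_pwDl ?expR_gt0 //.
by apply: sumr_ge0 => j _; exact: expR_ge0.
Qed.

Lemma softmax_gt0 (R : realType) (v : nat) (x : 'rV[R]_v) (i : 'I_v) :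
  0 < softmax x 0 i.
Proof. by rewrite mxE divr_gt0 ?expR_gt0 ?(sum_expR_gt0 x i). Qed.

Lemma ln_softmax (R : realType) (v : nat) (x : 'rV[R]_v) (i : 'I_v) :
  ln (softmax x 0 i) = x 0 i - ln (\sum_(j < v) expR (x 0 j)).
Proof.
by rewrite mxE ln_div ?posrE ?expR_gt0 ?(sum_expR_gt0 x i) // expRK.
Qed.

Theorem mainTheorem4 (R : realType) (v k : nat) (hk : (2 <= k)%N)
    (hkv : (k <= v)%N) (l : 'rV[R]_v) (beta_max : R)
    (tv : 'I_v) (htv : tv.+1 = v) :
  let l' := bias_logits k beta_max l in
  let p := softmax l in
  let p' := softmax l' in
  (forall j : 'I_v, p 0 j <= p 0 tv) ->
  forall i : 'I_v, (i.+1 < k)%N ->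
    p 0 i = expR (ln (p' 0 i) - beta_max - ln (p' 0 tv) + ln (p 0 tv)).
Proof.
move=> l' p p' _ i ik.
(* Since [p 0 i] is positive, it is the exponential of its logarithm, so comparing exponents
   suffices. *)
rewrite -[LHS]lnK ?posrE ?softmax_gt0 //; congr expR.
(* By [htv] the bias test at [tv] reads [v < k], which [hkv] refutes; at [i] it holds by [ik]. *)
rewrite !ln_softmax [l' 0 i]mxE [l' 0 tv]mxE ik htv ltnNge hkv /=.
(* The log-normalizer of [l'] cancels on the right; that of [l] occurs once on each side. *)
by ring.
Qed.
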